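(* Let $d\ge1$, $1\le n\le N\le\infty$ with $n$ finite, and let $\{\xi(i,m)\}$, $n\le i\le N$ ($i$ finite), $m=1,\dots,d$, be centered reverse martingale differences relative to one common reverse filtration $\{F(i)\}$, such that for each fixed $m$ the random variables $\xi(i,m)$, $n\le i\le N$, are independent (the vectors $\vec\xi(m)=\{\xi(i,m)\}_i$ for different $m$ may be dependent). Put $\nu_m^{(n)}(p)=\sup_{n\le i\le N}|\xi(i,m)|_p$ and assume that, for each $m$, $\nu_m^{(n)}\in G(\nu,r_m)$ for some $2<r_m\le\infty$, and that $r=\left(\sum_{m=1}^d1/r_m\right)^{-1}>1$. Define for $p\ge2$, by reverse recursion, $$\zeta_d(p)=K_I(p)\,\nu_d^{(n)}(p),\qquad \zeta_m(p)=K_M(p)\cdot(\zeta_{m+1}\otimes\nu_m^{(n)})(p),\quad m=d-1,d-2,\dots,1.$$ Then $$\sup_{b\in B}\|V_n^{(N)}(d,b)\|G(\zeta_1)\ \le\ \prod_{m=1}^d\|\vec\xi(m)\|G(\nu_m^{(n)},r_m),$$ where $\|V\|G(\zeta_1)=\sup_{p\in(2,r)}|V|_p/\zeta_1(p)$ and $\|\vec\xi(m)\|G(\nu_m^{(n)},r_m)=\sup_{p\in(2,r_m)}\sup_{n\le i\le N}|\xi(i,m)|_p/\nu_m^{(n)}(p)$.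
   Context: All random variables live on a probability space $(\Omega,F,\mathbf P)$; $|\xi|_p=(\mathbf E|\xi|^p)^{1/p}$; $1/\infty=0$, $1/0=\infty$. Suprema of nonnegative quantities over the empty set are $0$. Reverse martingale differences: $F(i+1)\subset F(i)\subset F$; each $\xi(i,m)$ is $F(i)$-measurable, $\mathbf E\xi(i,m)=0$, and $\mathbf E[\xi(i,m)\mid F(k)]=0$ a.s. for all $k=i+1,i+2,\dots$. The reverse filtration is the same for all $m=1,\dots,d$. Polynomial: $I_n^{(N)}(d)=\{(i_1,\dots,i_d):n\le i_1<i_2<\dots<i_d\le N\}$ (finite indices); for a real non-random array $b=(b(I))$ indexed by $I_n^{(N)}(d)$, $$V_n^{(N)}(d,b)=\sum_{I=(i_1,\dots,i_d)\in I_n^{(N)}(d)}b(I)\prod_{m=1}^d\xi(i_m,m).$$ For $N=\infty$ the sum is understood as the limit as $N\to\infty$ of the sums for finite $N$, for those $b$ for which this limit exists with probability one. $B=\{b:\sum_{I\in I_n^{(N)}(d)}b^2(I)=1\}$. Class $G(\nu,r)$ ($2<r\le\infty$): functions $\nu$ that are continuous, positive and finite on $[1,r)$, with $\inf_{p\in(2,r)}\nu(p)>0$ and $\nu(p)=\infty$ for $p>r$. Operation $\otimes$: $(\nu_1\otimes\nu_2)(p)=\inf\{\nu_1(p/a)\,\nu_2(p/b):a,b>0,\ a+b=1\}$, for functions with values in $(0,\infty]$. Constant $K_M(p)$, $p\ge2$: the smallest constant $K$ such that for every finite $n$, every sequence $\theta(1),\dots,\theta(n)$ of centered martingale differences relative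 to some filtration, and all real $b(1),\dots,b(n)$ with $\sum_i b^2(i)=1$, one has $\left|\sum_{i=1}^n b(i)\theta(i)\right|_p\le K\sup_i|\theta(i)|_p$. (It is known that $K_M(p)\le p\sqrt2$.) Constant $K_I(p)$, $p\ge2$: the smallest constant in the same inequality when $\theta(1),\dots,\theta(n)$ are restricted to be independent centered random variables. (It is known that $K_I(p)\le 0.87\,p/\log p$.) *)

(* Defs.v *)
From HB Require Import structures.
From mathcomp Require Export all_boot all_order all_algebra finmap.
From mathcomp Require Export all_classical all_reals all_analysis.
Set Implicit Arguments.
Unset Strict Implicit.
Unset Printing Implicit Defensive.
Import Order.TTheory GRing.Theory Num.Theory.
Import numFieldNormedType.Exports.

Local Open Scope classical_set_scope.
Local Open Scope ring_scope.

(* Supremum of nonnegative quantities: equal to 0, not -oo, on the empty set. *)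
Definition nnsup {R : realType} (A : set (\bar R)) : \bar R :=
  ereal_sup (0%E |` A).

Definition Lp_norm {d} {T : measurableType d} {R : realType}
    (P : probability T R) (p : R) (X : T -> R) : \bar R :=
  ('N[P]_(p%:E)[EFin \o X])%E.

Definition sub_sigma_algebra {d} {T : measurableType d} (G : set (set T)) :=
  sigma_algebra setT G /\ G `<=` measurable.

Definition measurable_wrt {d} {T : measurableType d} {R : realType}
    (G : set (set T)) (X : T -> R) :=
  forall B : set R, measurable B -> G (X @^-1` B).

(* E[X | G] = Y a.s.: for integrable X, the random variable Y is a version of
   the conditional expectation. *)
Definition is_cond_exp {d} {T : measurableType d} {R : realType}
    (P : probability T R) (G : set (set T)) (X Y : T -> R) :=
  [/\ measurable_wrt G Y,
      P.-integrable setT (EFin \o Y) &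
      forall A, G A ->
        (\int[P]_(w in A) (Y w)%:E = \int[P]_(w in A) (X w)%:E)%E].

Definition centered {d} {T : measurableType d} {R : realType}
    (P : probability T R) (X : T -> R) :=
  P.-integrable setT (EFin \o X) /\ ('E_P[X] = 0)%E.

Definition mutually_independent {d} {T : measurableType d} {R : realType}
    {I : choiceType} (P : probability T R) (A : set I) (X : I -> T -> R) :=
  forall (J : {fset I}) (B : I -> set R),
    [set` J] `<=` A -> (forall i, measurable (B i)) ->
    (P (\bigcap_(i in [set` J]) (X i @^-1` B i)) =
     \prod_(i <- J) P (X i @^-1` B i))%E.

Definition reverse_filtration {d} {T : measurableType d}
    (F : nat -> set (set T)) :=
  (forall i, sub_sigma_algebra (F i)) /\ (forall i, F i.+1 `<=` F i).

Definition reverse_martingale_differences {d} {T : measurableType d}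
    {R : realType} (P : probability T R) (A : set nat)
    (F : nat -> set (set T)) (X : nat -> T -> R) :=
  forall i, A i ->
    [/\ measurable_wrt (F i) (X i), centered P (X i) &
        forall k, (i < k)%N -> is_cond_exp P (F k) (X i) (cst 0)].

Definition filtration {d} {T : measurableType d} {n : nat}
    (F : 'I_n -> set (set T)) :=
  (forall i, sub_sigma_algebra (F i)) /\
  (forall i j : 'I_n, (i <= j)%N -> F i `<=` F j).

Definition martingale_differences {d} {T : measurableType d} {R : realType}
    {n : nat} (P : probability T R) (F : 'I_n -> set (set T))
    (X : 'I_n -> T -> R) :=
  forall i,
    [/\ measurable_wrt (F i) (X i), centered P (X i) &
        forall k : 'I_n, (k < i)%N -> is_cond_exp P (F k) (X i) (cst 0)].

(* |sum_i b(i) theta(i)|_p <= K sup_i |theta(i)|_p for all b on the unit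
   sphere. *)
Definition moment_bound {d} {T : measurableType d} {R : realType} {n : nat}
    (P : probability T R) (p K : R) (theta : 'I_n -> T -> R) :=
  forall b : 'I_n -> R, \sum_(i < n) (b i) ^+ 2 = 1 ->
    (Lp_norm P p (fun w => \sum_(i < n) b i * theta i w)%R <=
     K%:E * nnsup (range (fun i => Lp_norm P p (theta i))))%E.

(* The constants below do not depend on a probability space: all of them are
   quantified over.  An infimum equal to +oo would mean that no finite constant
   exists. *)
Definition K_M {R : realType} (p : R) : \bar R :=
  ereal_inf [set K%:E | K in [set K : R |
    forall (d : measure_display) (T : measurableType d) (P : probability T R)
      (n : nat) (F : 'I_n -> set (set T)) (theta : 'I_n -> {RV P >-> R}),
      filtration F -> martingale_differences P F theta ->
      moment_bound P p K theta]].

Definition K_I {R : realType} (p : R) : \bar R :=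
  ereal_inf [set K%:E | K in [set K : R |
    forall (d : measure_display) (T : measurableType d) (P : probability T R)
      (n : nat) (theta : 'I_n -> {RV P >-> R}),
      mutually_independent P setT theta -> (forall i, centered P (theta i)) ->
      moment_bound P p K theta]].

Definition class_G {R : realType} (nu : R -> \bar R) (r : \bar R) :=
  [/\ (2%:E < r)%E,
      {within [set p : R | (1 <= p)%R /\ (p%:E < r)%E], continuous nu},
      (forall p : R, (1 <= p)%R -> (p%:E < r)%E -> (0 < nu p < +oo)%E),
      (0 < ereal_inf [set nu p | p in [set p : R | (2 < p)%R /\ (p%:E < r)%E]])%E
    & (forall p : R, (r < p%:E)%E -> nu p = +oo%E)].

Definition otimes {R : realType} (nu1 nu2 : R -> \bar R) (p : R) : \bar R :=
  ereal_inf [set x | exists a b : R,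
    [/\ 0 < a, 0 < b, a + b = 1 & x = (nu1 (p / a)%R * nu2 (p / b)%R)%E]].

(* [zeta_from nu k m] is the function zeta_m when nu_{m+k} is the last one. *)
Fixpoint zeta_from {R : realType} (nu : nat -> R -> \bar R) (k m : nat)
    (p : R) : \bar R :=
  if k is k'.+1 then (K_M p * otimes (zeta_from nu k' m.+1) (nu m) p)%E
  else (K_I p * nu m p)%E.

Definition zeta {R : realType} (nu : nat -> R -> \bar R) (d m : nat) :
    R -> \bar R :=
  zeta_from nu (d - m) m.

Lemma zeta_last {R : realType} (nu : nat -> R -> \bar R) (d : nat) (p : R) :
  zeta nu d d p = (K_I p * nu d p)%E.
Proof. by rewrite /zeta subnn. Qed.

Lemma zeta_rec {R : realType} (nu : nat -> R -> \bar R) (d m : nat) (p : R) :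
  (m < d)%N -> zeta nu d m p = (K_M p * otimes (zeta nu d m.+1) (nu m) p)%E.
Proof. by move=> md; rewrite /zeta -(subnSK md). Qed.

(* The upper end N <= oo of the index range is an [option nat], with [None]
   standing for infinity. *)
Definition le_upper (i : nat) (N : option nat) : bool :=
  if N is Some M then (i <= M)%N else true.

Definition in_range (n : nat) (N : option nat) (i : nat) : bool :=
  (n <= i)%N && le_upper i N.

(* I_n^(N)(d): the tuples n <= i_1 < ... < i_d <= N; the tuple positions start
   at 0, so that i_m is [nth 0 I m.-1]. *)
Definition multi_indices (n : nat) (N : option nat) (d : nat) :
    set (d.-tuple nat) :=
  [set I : d.-tuple nat | sorted ltn I && all (in_range n N) I].
Arguments multi_indices n N d : clear implicits.

Definition V_finite {T : Type} {R : realType} (xi : nat -> nat -> T -> R)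
    (n M d : nat) (b : d.-tuple nat -> R) (w : T) : R :=
  \sum_(I \in multi_indices n (Some M) d)
    (b I * \prod_(1 <= m < d.+1) xi (nth 0%N I m.-1) m w).

Definition V {T : Type} {R : realType} (xi : nat -> nat -> T -> R)
    (n : nat) (N : option nat) (d : nat) (b : d.-tuple nat -> R) (w : T) : R :=
  if N is Some M then V_finite xi n M b w
  else limn (fun M : nat => V_finite xi n M b w).

Definition V_defined {d0} {T : measurableType d0} {R : realType}
    (P : probability T R) (xi : nat -> nat -> T -> R)
    (n : nat) (N : option nat) (d : nat) (b : d.-tuple nat -> R) : Prop :=
  if N is Some _ then True
  else {ae P, forall w, cvgn (fun M : nat => V_finite xi n M b w)}.

(* Arrays are total functions; only their values on I_n^(N)(d) matter. *)
Definition unit_arrays {R : realType} (n : nat) (N : option nat) (d : nat) :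
    set (d.-tuple nat -> R) :=
  [set b | (\esum_(I in multi_indices n N d) ((b I) ^+ 2)%:E = 1)%E].
Arguments unit_arrays {R} n N d.

Definition sup_moment {d} {T : measurableType d} {R : realType}
    (P : probability T R) (A : set nat) (X : nat -> T -> R) (p : R) : \bar R :=
  nnsup [set Lp_norm P p (X i) | i in A].

Definition G_norm {d} {T : measurableType d} {R : realType}
    (P : probability T R) (nu : R -> \bar R) (r : \bar R) (X : T -> R) :
    \bar R :=
  nnsup [set (Lp_norm P p X / nu p)%E
        | p in [set p : R | (2 < p)%R /\ (p%:E < r)%E]].

Definition G_norm_family {d} {T : measurableType d} {R : realType}
    (P : probability T R) (A : set nat) (nu : R -> \bar R) (r : \bar R)
    (X : nat -> T -> R) : \bar R :=
  nnsup [set nnsup [set (Lp_norm P p (X i) / nu p)%E | i in A]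
        | p in [set p : R | (2 < p)%R /\ (p%:E < r)%E]].

(* Main.v *)
(* Since nu_m is itself the supremum of the moments, each factor on the right
   is at least 1, and it suffices to show |V|_p <= zeta_1(p).  Split off the
   smallest index: V = sum_i xi(i,1) U_i, where U_i is a polynomial of degree
   d - 1 in the variables with indices > i, hence F(i+1)-measurable.  With q_i
   the sum of squares of the coefficients of U_i, the variables
   xi(i,1) U_i / sqrt q_i form a reverse martingale difference sequence, and
   Hoelder's inequality with the induction hypothesis bounds their p-norms by
   (zeta_2 (x) nu_1)(p); the constant K_M(p) then applies to the weights
   sqrt q_i.  In degree 1 independence allows K_I(p) instead.  The case N = oo
   follows by Fatou's lemma. *)
Require Import Defs.
From HB Require Import structures.
From mathcomp Require Import measurable_realfun.
Set Implicit Arguments.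
Unset Strict Implicit.
Unset Printing Implicit Defensive.
Import Order.TTheory GRing.Theory Num.Theory.
Import numFieldNormedType.Exports.

Local Open Scope classical_set_scope.
Local Open Scope ring_scope.

(** * Suprema and moments *)

Section nnsup.
Context {R : realType}.
Implicit Types (A : set (\bar R)) (x y : \bar R).
Local Open Scope ereal_scope.

Lemma nnsup_ge0 A : 0 <= nnsup A.
Proof. by apply: ereal_sup_ubound; left. Qed.

Lemma nnsup_ubound A x : A x -> x <= nnsup A.
Proof. by move=> Ax; apply: ereal_sup_ubound; right. Qed.

Lemma ge_nnsup A y : 0 <= y -> (forall x, A x -> x <= y) -> nnsup A <= y.
Proof. by move=> y0 Ay; apply: ge_ereal_sup => x [->//|/Ay]. Qed.

End nnsup.

Section Lp_norm_theory.
Context {d} {T : measurableType d} {R : realType} (P : probability T R).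
Implicit Types (X Y : T -> R) (p a b : R).
Local Open Scope ereal_scope.

Let measurable_norm_powR X p : measurable_fun setT X ->
  measurable_fun setT (fun w => (`|X w| `^ p)%:E : \bar R).
Proof.
move=> mX; apply/measurable_EFinP.
by apply: (measurableT_comp (measurable_powR _)); exact: measurableT_comp.
Qed.

Lemma Lp_norm_ge0 p X : 0 <= Lp_norm P p X.
Proof. exact: Lnorm_ge0. Qed.

Lemma Lp_normE p X :
  Lp_norm P p X = (\int[P]_w (`|X w| `^ p)%:E) `^ p^-1.
Proof. by rewrite /Lp_norm unlock. Qed.

Lemma Lp_normZ p a X : (0 < p)%R -> measurable_fun setT X ->
  Lp_norm P p (fun w => a * X w)%R = `|a|%:E * Lp_norm P p X.
Proof.
move=> p0 mX; rewrite !Lp_normE.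
under eq_integral do rewrite normrM powRM// EFinM.
rewrite ge0_integralZl_EFin ?powR_ge0//.
  rewrite poweRM ?lee_fin ?powR_ge0//.
    by rewrite poweR_EFin -powRrM divff ?gt_eqF// powRr1.
  by apply: integral_ge0 => w _; rewrite lee_fin powR_ge0.
exact: measurable_norm_powR.
Qed.

Lemma Lp_norm0_ae p X : (0 < p)%R -> measurable_fun setT X ->
  Lp_norm P p X = 0 -> {ae P, forall w, X w = 0%R}.
Proof.
move=> p0 mX /Lnorm_eq0_eq0 H.
have {}H := H ((measurable_EFinP _ _).2 mX) p0.
by apply: filterS H => w /= /(_ I) [].
Qed.

Lemma ae0_Lp_norm p X : (0 < p)%R -> measurable_fun setT X ->
  {ae P, forall w, X w = 0%R} -> Lp_norm P p X = 0.
Proof.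
move=> p0 mX X0; rewrite Lp_normE.
rewrite (@ae_eq_integral _ _ _ P setT (cst 0)) ?integral0//.
- by rewrite poweR0r// invr_neq0// gt_eqF.
- exact: measurable_norm_powR.
- by apply: filterS X0 => w /= -> _; rewrite normr0 powR0// gt_eqF.
Qed.

(** Hoelder's inequality with conjugate exponents 1/a and 1/b, applied to |X|^p and |Y|^p, followed
    by a p-th root. The parametrisation by [a + b = 1] is the one used in [otimes]. *)
Lemma Lp_norm_hoelder p a b X Y : (0 < p)%R -> (0 < a)%R -> (0 < b)%R ->
    (a + b = 1)%R -> measurable_fun setT X -> measurable_fun setT Y ->
  Lp_norm P p (fun w => X w * Y w)%R <=
  Lp_norm P (p / a)%R X * Lp_norm P (p / b)%R Y.
Proof.
move=> p0 a0 b0 ab1 mX mY.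
have mXp : measurable_fun setT (fun w => `|X w| `^ p)%R.
  exact/measurable_EFinP/measurable_norm_powR.
have mYp : measurable_fun setT (fun w => `|Y w| `^ p)%R.
  exact/measurable_EFinP/measurable_norm_powR.
have := @hoelder _ T R P (fun w => `|X w| `^ p)%R (fun w => `|Y w| `^ p)%R
  a^-1 b^-1 mXp mYp.
rewrite !invrK !invr_gt0 => /(_ a0 b0 ab1).
rewrite Lnorm1 unlock !invrK => H.
have {H} : \int[P]_w (`|X w * Y w| `^ p)%:E <=
    (\int[P]_w (`|X w| `^ (p / a))%:E) `^ a *
    (\int[P]_w (`|Y w| `^ (p / b))%:E) `^ b.
  apply: le_trans (le_trans H _).
    rewrite le_eqVlt; apply/predU1P; left; apply: eq_integral => w _ /=.
    by rewrite [X in _ = X%:E]ger0_norm ?mulr_ge0 ?powR_ge0// normrM powRM.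
  rewrite le_eqVlt; apply/predU1P; left; congr (_ `^ _ * _ `^ _); apply: eq_integral => w _ /=;
    by rewrite [X in (X `^ _)%R]ger0_norm ?powR_ge0// -powRrM.
move=> /(gt0_ler_poweR (ltW (divr_gt0 ltr01 p0))).
have i0 q (Z : T -> R) : 0 <= \int[P]_w (`|Z w| `^ q)%:E.
  by apply: integral_ge0 => w _; rewrite lee_fin powR_ge0.
rewrite !in_itv/= !leey !andbT i0 mule_ge0 ?poweR_ge0// div1r.
move=> /(_ isT isT).
rewrite poweRM ?poweR_ge0// -!poweRrM !Lp_normE.
by rewrite !invf_div.
Qed.

(** On a probability space L^p is contained in L^1 for p at least 1. *)
Lemma Lp_norm_integrable p X : (1 <= p)%R -> measurable_fun setT X ->
  Lp_norm P p X < +oo -> P.-integrable setT (EFin \o X).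
Proof.
move=> p1 mX Xp; apply/Lfun1_integrable.
apply: (@Lfun_subset _ _ _ P 1 p%:E) => //.
- exact: fin_num_measure.
- by rewrite inE; apply/andP; split; rewrite inE.
Qed.

End Lp_norm_theory.

(** * Moments of an almost sure limit *)

Section Lp_norm_fatou.
Context {d} {T : measurableType d} {R : realType} (P : probability T R).
Implicit Types (X : nat -> T -> R) (p : R) (S : \bar R).

(** [limn] takes the default value [point] where the sequence diverges. Convergence holds exactly
    where the upper and lower limits agree and are finite, which is a measurable condition, and
    there the limit is their common value. *)
Lemma measurable_fun_limn X : (forall n, measurable_fun setT (X n)) ->
  measurable_fun setT (fun w => limn (X ^~ w)).
Proof.
move=> mX.
pose s w := limn_esup (fun n => (X n w)%:E).
pose i w := limn_einf (fun n => (X n w)%:E).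
have ms : measurable_fun setT s.
  by apply: measurable_fun_limn_esup => n; exact/measurable_EFinP.
have mi : measurable_fun setT i.
  rewrite (_ : i = \- (fun w => limn_esup (fun n => (- X n w)%:E)))%E; last first.
    by [].
  apply: measurableT_comp => //.
  apply: measurable_fun_limn_esup => n; apply/measurable_EFinP.
  exact: measurableT_comp.
rewrite (_ : (fun _ => _) = fun w =>
    if (s w == i w) && (s w \is a fin_num) then fine (s w) else point).
  apply: measurable_fun_ifT => //.
  - apply: measurable_and; first exact: measurable_fun_eqe.
    by apply: (measurable_fun_bool true) => //; exact: emeasurable_fin_num.
  - exact: measurableT_comp.
apply/funext => w; case: ifPn => [/andP[/eqP si sf]|siN].
  apply: cvg_lim => //.
  suff /fine_cvg : (fun n => (X n w)%:E) @ \oo --> (fine (s w))%:E by [].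
  rewrite fineK//; apply: (@squeeze_cvge _ _ _ _
    (einfs (fun n => (X n w)%:E)) _ (esups (fun n => (X n w)%:E))).
  - apply: nearW => n; apply/andP; split.
      by apply: ereal_inf_lbound; exists n => /=.
    by apply: ereal_sup_ubound; exists n => /=.
  - rewrite si /i limn_einf_lim; exact: is_cvg_einfs.
  - rewrite /s limn_esup_lim; exact: is_cvg_esups.
rewrite dvgP// => /cvg_ex[l Xl]; move/negP : siN; apply.
have /cvg_limn_einf_sup[il sl] : (fun n => (X n w)%:E) @ \oo --> l%:E.
  by apply: cvg_EFin; [exact: nearW|exact: Xl].
by rewrite /s /i sl il eqxx.
Qed.

Let powR_liminf (u : nat -> R) (l p : R) : 0 < p -> u @ \oo --> l ->
  ((`|l| `^ p)%:E <= limn_einf (fun n => (`|u n| `^ p)%:E))%E.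
Proof.
(* Continuity of the power is derived from its differentiability, available at positive points only.
   At [l = 0] the left-hand side is 0 and nonnegativity suffices. *)
move=> p0 /cvg_norm ul; have [->|l0] := eqVneq l 0.
  rewrite normr0 powR0 ?gt_eqF// limn_einf_lim.
  apply: lime_ge; first exact: is_cvg_einfs.
  apply: nearW => n; apply: le_ereal_inf_tmp => _ [k _ <-].
  by rewrite lee_fin powR_ge0.
suff /cvg_limn_einf_sup[-> _] :
  (fun n => (`|u n| `^ p)%:E) @ \oo --> (`|l| `^ p)%:E by [].
apply: cvg_EFin; first exact: nearW.
have cp : {for `|l|, continuous (fun x : R => x `^ p)}.
  apply/differentiable_continuous/derivable1_diffP/derivable_powR.
  by rewrite in_itv/= andbT normr_gt0.
exact: continuous_cvg cp ul.
Qed.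

Lemma Lp_norm_limn p X S : 0 < p -> (forall n, measurable_fun setT (X n)) ->
  {ae P, forall w, cvgn (X ^~ w)} -> (forall n, (Lp_norm P p (X n) <= S)%E) ->
  (Lp_norm P p (fun w => limn (X ^~ w)) <= S)%E.
Proof.
move=> p0 mX cX XS.
have mp (Y : T -> R) : measurable_fun setT Y ->
    measurable_fun setT (fun w => (`|Y w| `^ p)%:E).
  move=> mY; apply/measurable_EFinP.
  by apply: (measurableT_comp (measurable_powR _)); exact: measurableT_comp.
have i0 (Y : T -> R) : (0 <= \int[P]_w (`|Y w| `^ p)%:E)%E.
  by apply: integral_ge0 => w _; rewrite lee_fin powR_ge0.
have S0 : (0 <= S)%E by apply: le_trans (XS 0%N); exact: Lp_norm_ge0.
have pN0 : p != 0 by rewrite gt_eqF.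
(* Fatou's lemma is applied to the p-th powers, and the root is taken at the end. Points without a
   limit form a null set, so the pointwise comparison is only needed almost everywhere. *)
have main : (\int[P]_w (`|limn (X ^~ w)| `^ p)%:E <= S `^ p)%E.
  apply: (@le_trans _ _ (\int[P]_w limn_einf (fun n => (`|X n w| `^ p)%:E))%E).
    apply: ae_ge0_le_integral => //.
    - exact/mp/measurable_fun_limn.
    - move=> w _; rewrite limn_einf_lim.
      apply: lime_ge; first exact: is_cvg_einfs.
      apply: nearW => n; apply: le_ereal_inf_tmp => _ [k _ <-].
      by rewrite lee_fin powR_ge0.
    - apply: measurableT_comp => //.
      apply: measurable_fun_limn_esup => n; apply: measurableT_comp => //.
      exact: mp.
    - by apply: filterS cX => w /= cXw _; exact: powR_liminf.
  have f0 n w : setT w -> (0 <= (`|X n w| `^ p)%:E)%E.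
    by move=> _; rewrite lee_fin powR_ge0.
  apply: le_trans (fatou P measurableT (fun n => mp _ (mX n)) f0) _.
  rewrite limn_einf_lim; apply: lime_le; first exact: is_cvg_einfs.
  apply: nearW => n; apply: (@le_trans _ _ (\int[P]_w (`|X n w| `^ p)%:E)%E).
    by apply: ereal_inf_lbound; exists n => /=.
  rewrite -(poweRe1 (i0 _)) -(mulVf pN0) poweRrM -Lp_normE.
  by apply: gt0_ler_poweR; rewrite ?in_itv/= ?leey ?andbT ?Lp_norm_ge0// ltW.
rewrite -(poweRe1 S0) -(divff pN0) poweRrM Lp_normE.
apply: gt0_ler_poweR main; rewrite ?in_itv/= ?leey ?andbT ?invr_ge0 ?poweR_ge0//.
exact: ltW.
Qed.

End Lp_norm_fatou.

(** * The constants K_M and K_I *)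

Section moment_constants.
Context {R : realType}.
Implicit Types (p K : R) (S : \bar R).

(* A fair sign shows that K_M and K_I are at least 1, which excludes the product
   [0 * +oo = 0] when the moments on the other side are infinite. *)
Let rademacher (b : bool) : R := if b then 1 else -1.

Let measurable_rademacher : measurable_fun setT rademacher.
Proof. by []. Qed.

HB.instance Definition _ := isMeasurableFun.Build _ _ bool R rademacher
  measurable_rademacher.

Let half01 : 0 <= (2^-1 : R) <= 1.
Proof. by rewrite invr_ge0 ler0n/= invf_le1 ?ler1n. Qed.

Let half2 : 2^-1 + (unstable.onem 2^-1) = 1 :> R.
Proof. by rewrite /unstable.onem addrC subrK. Qed.

Let coin : probability bool R := bernoulli_prob (2^-1 : R).

Let integral_norm_rademacher (f : bool -> R) : (forall b, f b = 1) ->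
  (\int[coin]_b (f b)%:E = 1)%E.
Proof.
move=> f1; rewrite integral_bernoulli_prob//; last by move=> b; rewrite f1 lee01.
by rewrite !f1 !mule1 -EFinD half2.
Qed.

Let Lp_norm_rademacher p : Lp_norm coin p rademacher = 1%E.
Proof.
rewrite Lp_normE integral_norm_rademacher ?poweR1r// => -[];
  by rewrite /rademacher ?normrN normr1 powR1.
Qed.

Let centered_rademacher : centered coin rademacher.
Proof.
split.
  apply: (@Lp_norm_integrable _ _ _ _ 1) => //.
  by rewrite Lp_norm_rademacher ltry.
(* The formula for the Bernoulli integral is for nonnegative functions, hence the split into
   positive and negative parts; each of them integrates to one half. *)
rewrite unlock integralE !integral_bernoulli_prob//.
rewrite !(funeposE, funenegE)/= -!EFin_max opprK (max_l (@ler01 R)) (max_r (lerN10 R)).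
rewrite !mule1 -!EFinM -!EFinD; congr EFin.
have -> : unstable.onem 2^-1 = 2^-1 :> R.
  by rewrite /unstable.onem [X in X - _](splitr 1) div1r addrK.
by rewrite mulr0 addr0 add0r subrr.
Qed.

Let moment_bound_rademacher p K :
  moment_bound coin p K (fun _ : 'I_1 => rademacher) -> 1 <= K.
Proof.
move=> /(_ (fun=> 1)); rewrite big_ord1 expr1n => /(_ erefl).
rewrite (_ : (fun w => _) = rademacher); last first.
  by apply/funext => w; rewrite big_ord1 mul1r.
rewrite Lp_norm_rademacher => /le_trans H; rewrite -lee_fin -[leRHS]mule1.
(* A negative [K] would make the right-hand side at most 0, while the sign has moment 1. Once [K] is
   nonnegative, the supremum can be replaced by 1. *)
have K0 : 0 <= K.
  rewrite leNgt; apply/negP => K0.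
  suff : (1 <= 0 :> \bar R)%E by rewrite lee_fin ler10.
  by apply: H; apply: mule_le0_ge0; [rewrite lee_fin ltW|exact: nnsup_ge0].
apply: H; apply: lee_wpmul2l; first by rewrite lee_fin.
by apply: ge_nnsup => // _ [i _ <-].
Qed.

Lemma K_M_ge1 p : (1 <= K_M p)%E.
Proof.
apply: le_ereal_inf_tmp => _ [K + <-].
move=> /(_ _ bool coin 1%N (fun=> measurable) (fun=> rademacher)) H.
rewrite lee_fin; apply: (@moment_bound_rademacher p); apply: H.
- split=> // i; split => //; exact: sigma_algebra_measurable.
(* With a single index there is no earlier one, so the conditional requirement is vacuous. *)
- by move=> i; split => // k; rewrite !ord1.
Qed.

Lemma K_I_ge1 p : (1 <= K_I p)%E.
Proof.
apply: le_ereal_inf_tmp => _ [K + <-].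
move=> /(_ _ bool coin 1%N (fun=> rademacher)) H.
rewrite lee_fin; apply: (@moment_bound_rademacher p); apply: H => // J B _ mB.
have [J0|J0] := boolP (ord0 \in J).
  have -> : J = [fset ord0]%fset.
    by apply/fsetP => i; rewrite inE ord1 J0 eqxx.
  by rewrite big_seq_fset1 set_fset1 bigcap_set1.
have -> : J = fset0.
  by apply/fsetP => i; rewrite inE ord1 (negbTE J0).
by rewrite big_seq_fset0 set_fset0 bigcap_set0 probability_setT.
Qed.

(* The case [S = 0] needs its own hypothesis: [A] may be empty, and then the
   right-hand side is [+oo * 0 = 0]. *)
Lemma le_ereal_inf_mul (A : set R) (L S : \bar R) :
    (0 <= S)%E -> (forall K, A K -> 1 <= K) -> (S = 0 -> L <= 0)%E ->
    (S < +oo -> forall K, A K -> L <= K%:E * S)%E ->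
  (L <= ereal_inf [set K%:E | K in A] * S)%E.
Proof.
move=> S0 A1 L0 LA.
have i1 : (1 <= ereal_inf [set K%:E | K in A])%E.
  by apply: le_ereal_inf_tmp => _ [K AK <-]; rewrite lee_fin A1.
have [Soo|] := eqVneq S +oo%E.
  by rewrite Soo muleC gt0_mulye ?leey// (lt_le_trans _ i1).
rewrite -ltey => Soo; have := S0; rewrite le_eqVlt => /predU1P[S00|Spos].
  by rewrite -S00 mule0 L0.
(* For finite positive [S], division by [S] turns the claim into a lower bound for every admissible
   constant. *)
have Sfin : S \is a fin_num by rewrite ge0_fin_numE.
rewrite -(fineK Sfin) -lee_pdivrMr ?fine_gt0 ?Spos//.
apply: le_ereal_inf_tmp => _ [K AK <-].
by rewrite lee_pdivrMr ?fine_gt0 ?Spos// fineK// LA.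
Qed.

Section bounds.
Context {d} {T : measurableType d} (P : probability T R).
Variables (p : R) (S : \bar R) (n : nat) (theta : 'I_n -> {RV P >-> R}).
Variable b : 'I_n -> R.
Hypotheses (p0 : 0 < p) (S0 : (0 <= S)%E) (b1 : \sum_(i < n) b i ^+ 2 = 1).
Hypothesis thetaS : forall i, (Lp_norm P p (theta i) <= S)%E.

(** Each of the finitely many variables vanishes almost surely, hence so does their combination. *)
Let null_sum : S = 0%E ->
  (Lp_norm P p (fun w => \sum_(i < n) b i * theta i w)%R <= 0)%E.
Proof.
move=> S00; rewrite ae0_Lp_norm//.
  apply: measurable_sum => i; exact: measurable_funM.
have theta0 i : {ae P, forall w, theta i w = 0}.
  apply: (@Lp_norm0_ae _ _ _ _ p) => //.
  by apply/eqP; rewrite eq_le Lp_norm_ge0 -S00 thetaS.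
have : {ae P, forall w i, theta i w = 0} by exact: filter_forall.
apply: filterS => w t0; rewrite big1// => i _; by rewrite t0 mulr0.
Qed.

Let sup_theta : (nnsup (range (fun i => Lp_norm P p (theta i))) <= S)%E.
Proof. by apply: ge_nnsup => // _ [i _ <-]. Qed.

(** The martingale property is asked for finite [S] only, because the integrability of products will
    come from the finiteness of their moments. *)
Lemma K_M_bound (F : 'I_n -> set (set T)) : filtration F ->
    (S < +oo -> martingale_differences P F theta)%E ->
  (Lp_norm P p (fun w => \sum_(i < n) b i * theta i w)%R <= K_M p * S)%E.
Proof.
move=> filF dF; apply: le_ereal_inf_mul => // [K AK|Soo K AK].
  by rewrite -lee_fin (le_trans (K_M_ge1 p))//; apply: ereal_inf_lbound; exists K.
apply: le_trans (AK _ _ _ _ _ _ filF (dF Soo) b b1) _.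
apply: lee_wpmul2l sup_theta.
rewrite lee_fin (le_trans ler01)// -lee_fin (le_trans (K_M_ge1 p))//.
by apply: ereal_inf_lbound; exists K.
Qed.

Lemma K_I_bound : mutually_independent P setT theta ->
    (forall i, centered P (theta i)) ->
  (Lp_norm P p (fun w => \sum_(i < n) b i * theta i w)%R <= K_I p * S)%E.
Proof.
move=> ind cen; apply: le_ereal_inf_mul => // [K AK|_ K AK].
  by rewrite -lee_fin (le_trans (K_I_ge1 p))//; apply: ereal_inf_lbound; exists K.
apply: le_trans (AK _ _ _ _ _ ind cen b b1) _.
apply: lee_wpmul2l sup_theta.
rewrite lee_fin (le_trans ler01)// -lee_fin (le_trans (K_I_ge1 p))//.
by apply: ereal_inf_lbound; exists K.
Qed.

End bounds.

End moment_constants.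

(** * Products with vanishing conditional expectation *)

Section sub_sigma_algebra_theory.
Context {d} {T : measurableType d} {R : realType}.
Variable G : set (set T).
Hypothesis sG : sub_sigma_algebra G.
Implicit Types X Y : T -> R.

(** A sigma-algebra generates itself; this gives access to the closure properties of measurable
    functions on the type equipped with [G]. *)
Lemma measurable_wrtP X : measurable_wrt G X <->
  measurable_fun setT (X : g_sigma_algebraType G -> R).
Proof.
have mG := measurable_g_measurableTypeE sG.1.
split=> [mX _ B mB|mX B mB]; first by rewrite setTI mG; exact: mX.
by have := mX measurableT B mB; rewrite setTI mG.
Qed.

Lemma measurable_wrt_measurable_fun X :
  measurable_wrt G X -> measurable_fun setT X.
Proof. by move=> mX _ B mB; rewrite setTI; exact/sG.2/mX. Qed.

Lemma measurable_wrt_sum (I : Type) (s : seq I) (X : I -> T -> R) :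
    (forall i, measurable_wrt G (X i)) ->
  measurable_wrt G (fun w => \sum_(i <- s) X i w).
Proof.
move=> mX; apply/measurable_wrtP; apply: measurable_sum => i.
exact/measurable_wrtP.
Qed.

Lemma measurable_wrtM X Y : measurable_wrt G X -> measurable_wrt G Y ->
  measurable_wrt G (fun w => X w * Y w).
Proof.
move=> /measurable_wrtP mX /measurable_wrtP mY; apply/measurable_wrtP.
exact: measurable_funM.
Qed.

Lemma measurable_wrt_cst (c : R) : measurable_wrt G (cst c : T -> R).
Proof. by apply/measurable_wrtP. Qed.

Lemma measurable_wrt_indic A : G A -> measurable_wrt G (\1_A : T -> R).
Proof.
move=> GA; apply/measurable_wrtP; apply: measurable_indic.
by rewrite measurable_g_measurableTypeE//; exact: sG.1.
Qed.

End sub_sigma_algebra_theory.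

Import HBNNSimple.

Section orthogonality.
Context {d} {T : measurableType d} {R : realType} (P : probability T R).
Variables (G : set (set T)) (X : T -> R).
Hypotheses (sG : sub_sigma_algebra G)
  (iX : P.-integrable setT (EFin \o X)) (X0 : is_cond_exp P G X (cst 0)).
Implicit Types Y : T -> R.
Local Open Scope ereal_scope.

Let X0E A : G A -> \int[P]_(w in A) (X w)%:E = 0.
Proof. by case: X0 => _ _ /(_ A) + GA => /(_ GA) <-; rewrite integral0. Qed.

Let integral_indic (c : R) A : G A ->
  P.-integrable setT (fun w => (X w * (c * \1_A w))%:E) /\
  \int[P]_w (X w * (c * \1_A w))%:E = 0.
Proof.
move=> GA; have mA : measurable A by exact: sG.2.
have E : (fun w => (X w * (c * \1_A w))%:E) =
    (fun w => c%:E * ((EFin \o X) \_ A) w).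
  apply/funext => w; rewrite epatch_indic/= -!EFinM; congr EFin.
  by rewrite mulrCA.
have iA : P.-integrable setT ((EFin \o X) \_ A).
  by apply/(integrable_mkcond _ mA); exact: integrableS iX.
split; first by rewrite E; exact: integrableZl.
by rewrite E integralZl// -integral_mkcond X0E// mule0.
Qed.

(** A simple function is a finite combination of indicators of its level sets, which belong to
    [G]. *)
Let integral_nnsfun (g : {nnsfun (g_sigma_algebraType G) >-> R}) :
  \int[P]_w (X w * g w)%:E = 0.
Proof.
pose h y w := (X w * (y * \1_(g @^-1` [set y]) w))%:E.
have Gy y : G (g @^-1` [set y]).
  have : G.-sigma.-measurable (g @^-1` [set y]) by exact: measurable_funPTI.
  by rewrite measurable_g_measurableTypeE//; exact: sG.1.
rewrite (eq_integral (fun w => \sum_(y <- fset_set (range g)) h y w)); last first.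
  move=> w _; rewrite {1}(fimfunE g w) fsbig_finite//=.
  by rewrite mulr_sumr -sumEFin.
rewrite integral_sum//; last by move=> y; exact: (integral_indic _ (Gy y)).1.
by rewrite big1// => y _; exact: (integral_indic _ (Gy y)).2.
Qed.

(** Dominated convergence: [Y] is the limit of simple functions lying below it and measurable for
    [G], so |X Y| dominates all the products. *)
Let integral_nneg Y : measurable_wrt G Y -> (forall w, 0 <= Y w)%R ->
  P.-integrable setT (fun w => (X w * Y w)%:E) ->
  \int[P]_w (X w * Y w)%:E = 0.
Proof.
move=> mY Y0 iXY.
have mX : measurable_fun setT X by case/integrableP : iX => /measurable_EFinP.
have mG : measurable_fun setT (EFin \o Y : g_sigma_algebraType G -> \bar R).
  by apply/measurable_EFinP/measurable_wrtP.
pose g := nnsfun_approx measurableT mG.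
have := @dominated_convergence _ _ _ P setT measurableT
  (fun n w => (X w * g n w)%:E) (fun w => (X w * Y w)%:E)
  (fun w => `|(X w * Y w)%:E|).
have mgn n : measurable_fun setT (g n : T -> R).
  apply: (measurable_wrt_measurable_fun sG); apply/measurable_wrtP => //.
case.
- by move=> n; apply/measurable_EFinP; exact: measurable_funM.
- by case/integrableP : iXY.
- apply: aeW => w _; under eq_fun do rewrite EFinM.
  rewrite EFinM; apply: cvgeZl => //.
  by apply: (@cvg_nnsfun_approx _ _ _ _ measurableT _ mG) => // v _; rewrite lee_fin.
- exact: integrable_abse.
- apply: aeW => w n _; rewrite /= lee_fin !normrM ler_wpM2l//.
  rewrite !ger0_norm// -lee_fin /g nnsfun_approxE.
  by apply: le_approx => // v _; rewrite lee_fin.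
move=> _ _ /(cvg_lim (@ereal_hausdorff R)) <-.
under eq_fun do rewrite integral_nnsfun.
exact: lim_cst.
Qed.

(** The positive and negative parts of [Y] are treated separately; their products with [X] are
    integrable because they are dominated by |X Y|. *)
Lemma integral_mul_cond_exp0 Y : measurable_wrt G Y ->
  P.-integrable setT (fun w => (X w * Y w)%:E) ->
  \int[P]_w (X w * Y w)%:E = 0.
Proof.
move=> mY iXY.
have mX : measurable_fun setT X by case/integrableP : iX => /measurable_EFinP.
pose Yp w := Num.max (Y w) 0%R; pose Yn w := Num.max (- Y w)%R 0%R.
have YpnE w : Y w = (Yp w - Yn w)%R.
  rewrite /Yp /Yn; have [y0|y0] := leP 0%R (Y w).
    by rewrite max_r ?oppr_le0// subr0.
  by rewrite max_l ?oppr_ge0 ?ltW// opprK add0r.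
have mYp : measurable_wrt G Yp.
  by apply/measurable_wrtP/measurable_maxr => //; exact/measurable_wrtP.
have mYn : measurable_wrt G Yn.
  apply/measurable_wrtP/measurable_maxr => //.
  by apply: measurableT_comp => //; exact/measurable_wrtP.
have Yp0 w : (0 <= Yp w)%R by rewrite le_max lexx orbT.
have Yn0 w : (0 <= Yn w)%R by rewrite le_max lexx orbT.
have iXZ Z : measurable_wrt G Z -> (forall w, `|Z w| <= `|Y w|)%R ->
    P.-integrable setT (fun w => (X w * Z w)%:E).
  move=> mZ ZY; apply: le_integrable iXY => //.
    apply/measurable_EFinP; apply: measurable_funM => //.
    exact: measurable_wrt_measurable_fun mZ.
  by move=> w _; rewrite /= lee_fin !normrM ler_wpM2l.
have iXYp : P.-integrable setT (fun w => (X w * Yp w)%:E).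
  apply: iXZ => // w; rewrite (ger0_norm (Yp0 w)) /Yp.
  by rewrite ge_max normr_ge0 ler_norm.
have iXYn : P.-integrable setT (fun w => (X w * Yn w)%:E).
  apply: iXZ => // w; rewrite (ger0_norm (Yn0 w)) /Yn.
  by rewrite ge_max normr_ge0 -normrN ler_norm.
under eq_integral do rewrite YpnE mulrBr EFinB.
by rewrite integralB// !integral_nneg// subee.
Qed.

(** For [A] in [H], the integral of X Y over [A] is that of [X] against Y times the indicator of
    [A], which is still measurable for [G]. *)
Lemma is_cond_exp0M (H : set (set T)) Y :
    sub_sigma_algebra H -> H `<=` G -> measurable_wrt G Y ->
    P.-integrable setT (fun w => (X w * Y w)%:E) ->
  is_cond_exp P H (fun w => X w * Y w)%R (cst 0%R).
Proof.
move=> sH HG mY iXY; split.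
- exact: measurable_wrt_cst.
- exact: integrable0.
move=> A HA; rewrite integral0 integral_mkcond.
have mA : measurable A by exact: sH.2.
have E : (EFin \o (fun w => X w * Y w)%R) \_ A =
   fun w => (X w * (Y w * \1_A w))%:E.
  by apply/funext => w; rewrite epatch_indic/= -EFinM mulrA.
rewrite E integral_mul_cond_exp0//.
  by apply: measurable_wrtM => //; apply: measurable_wrt_indic => //; exact: HG.
by rewrite -E; apply/(integrable_mkcond _ mA); exact: integrableS iXY.
Qed.

End orthogonality.

(** * Sums over increasing multi-indices *)

(** The smallest index is the outermost summation variable, so that induction on [k] splits it
    off. *)
Fixpoint multi_sum {V : nmodType} (M k n : nat) (g : seq nat -> V) : V :=
  if k is k'.+1 then
    \sum_(n <= i < M.+1) multi_sum M k' i.+1 (fun s => g (i :: s))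
  else g [::].

(* The polynomial in xi(i_1,m), ..., xi(i_k,m+k-1) summed over
   n <= i_1 < ... < i_k <= M. *)
Fixpoint multi_poly {T : Type} {R : realType} (xi : nat -> nat -> T -> R)
    (M k m n : nat) (c : seq nat -> R) (w : T) : R :=
  if k is k'.+1 then
    \sum_(n <= i < M.+1)
      xi i m w * multi_poly xi M k' m.+1 i.+1 (fun s => c (i :: s)) w
  else c [::].

(** A duplicate-free enumeration that links the nested sums to the sums over the set
    [multi_indices]. *)
Fixpoint increasing_seqs (M k n : nat) : seq (seq nat) :=
  if k is k'.+1 then
    [seq i :: s | i <- index_iota n M.+1, s <- increasing_seqs M k' i.+1]
  else [:: [::]].

Lemma mem_increasing_seqs M k n s : (s \in increasing_seqs M k n) =
  [&& size s == k, sorted ltn s & all (in_range n (Some M)) s].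
Proof.
elim: k n s => [|k IH] n s /=; first by rewrite inE; case: s.
apply/allpairsPdep/idP => [[i [t [+ + ->]]]|].
  rewrite mem_index_iota IH /= => /andP[ni iM] /and3P[/eqP-> st /allP rt].
  rewrite ltnS in iM; rewrite eqxx /= (path_sortedE ltn_trans) st andbT /in_range/= ni iM/=.
  apply/andP; split; apply/allP => j /rt /andP[ij jM]//.
  by rewrite /in_range (leq_trans ni (ltnW ij)).
case: s => [//|i t] /and3P[/= kt].
rewrite (path_sortedE ltn_trans) => /andP[/allP it st].
move=> /andP[/andP[ni iM] /allP rt]; exists i, t; split => //.
  by rewrite mem_index_iota ni ltnS.
rewrite IH -eqSS kt st; apply/allP => j jt; rewrite /in_range it//.
by have /andP[] := rt _ jt.
Qed.

Lemma uniq_increasing_seqs M k n : uniq (increasing_seqs M k n).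
Proof.
elim: k n => [//|k IH] n /=; apply: allpairs_uniq_dep => //.
  exact: iota_uniq.
by move=> [i s] [j t] _ _ /= [-> ->].
Qed.

Lemma multi_sumE (V : nmodType) M k n (g : seq nat -> V) :
  multi_sum M k n g = \sum_(s <- increasing_seqs M k n) g s.
Proof.
elim: k n g => [|k IH] n g /=; first by rewrite big_seq1.
by rewrite big_allpairs_dep; apply: eq_bigr => i _; exact: IH.
Qed.

Lemma multi_indicesE M d n :
  (val : d.-tuple nat -> seq nat) @` multi_indices n (Some M) d =
  [set` increasing_seqs M d n].
Proof.
apply/seteqP; split => [_ [t ht <-]|s] /=.
  by rewrite mem_increasing_seqs size_tuple eqxx.
rewrite mem_increasing_seqs => /andP[sd hs].
by exists (Tuple sd).
Qed.

Lemma finite_multi_indices M d n : finite_set (multi_indices n (Some M) d).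
Proof.
apply: (@sub_finite_set _ _
    ((val : d.-tuple nat -> seq nat) @^-1` [set` increasing_seqs M d n])).
  by move=> t ht; rewrite -multi_indicesE; exists t.
by apply: finite_preimage => // x y _ _; exact: val_inj.
Qed.

Lemma fsum_multi_indices (V : nmodType) M d n (g : seq nat -> V) :
  \sum_(I \in multi_indices n (Some M) d) g (val I) = multi_sum M d n g.
Proof.
rewrite multi_sumE (fsbig_seq _ _ (uniq_increasing_seqs M d n)) -multi_indicesE.
by rewrite fsbig_image// => x y _ _; exact: val_inj.
Qed.

Lemma multi_sumZ (R : pzSemiRingType) M k n (a : R) (g : seq nat -> R) :
  multi_sum M k n (fun s => a * g s) = a * multi_sum M k n g.
Proof. by rewrite !multi_sumE mulr_sumr. Qed.

Lemma multi_polyE {T : Type} {R : realType} (xi : nat -> nat -> T -> R)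
    M k m n c w : multi_poly xi M k m n c w =
  multi_sum M k n
    (fun s => c s * \prod_(0 <= j < k) xi (nth 0%N s j) (m + j)%N w).
Proof.
elim: k m n c => [|k IH] m n c /=; first by rewrite big_geq// mulr1.
apply: eq_bigr => i _; rewrite IH -multi_sumZ !multi_sumE; apply: eq_bigr => s _.
rewrite big_nat_recl//= addn0 mulrCA; congr (_ * (_ * _)).
by apply: eq_bigr => j _; rewrite addSnnS.
Qed.

(** Every coefficient that occurs is zero, so the polynomial vanishes at every point. This covers
    the indices at which normalisation would divide by zero. *)
Lemma multi_poly_eq0 {T : Type} {R : realType} (xi : nat -> nat -> T -> R)
    M k m n c w : multi_sum M k n (fun s => c s ^+ 2) = 0 ->
  multi_poly xi M k m n c w = 0.
Proof.
rewrite multi_polyE !multi_sumE => /eqP.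
rewrite psumr_eq0; last by move=> s _; exact: sqr_ge0.
move=> /allP c0; rewrite big_seq big1// => s /c0.
by rewrite sqrf_eq0 => /eqP ->; rewrite mul0r.
Qed.

(** [insubd] extends [b] to all sequences. Those of the wrong length receive the value at the zero
    tuple, but do not occur in the sum. *)
Lemma V_finiteE {T : Type} {R : realType} (xi : nat -> nat -> T -> R)
    n M d (b : d.-tuple nat -> R) w :
  V_finite xi n M b w =
  multi_poly xi M d 1 n (fun s => b (insubd (nseq_tuple d 0%N) s)) w.
Proof.
rewrite multi_polyE -fsum_multi_indices /V_finite; apply: eq_fsbigr => I _.
by rewrite valKd big_add1.
Qed.

(** As [j] increases, [M - j] descends from [M] to [n], which is the order in which a reverse
    filtration grows. If [n] exceeds [M], truncated subtraction makes both sums empty. *)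
Lemma sum_rev_ord (V : nmodType) (n M : nat) (f : nat -> V) :
  \sum_(n <= i < M.+1) f i = \sum_(j < M.+1 - n) f (M - j)%N.
Proof.
rewrite big_nat_rev -{1}(add0n n) big_addn big_mkord.
by apply: eq_bigr => j _; congr f; rewrite addnS addnC subSS subnDr.
Qed.

(** * The moment estimate *)

Lemma otimes_ge0 {R : realType} (nu1 nu2 : R -> \bar R) (p : R) :
  (forall q, 0 <= nu1 q)%E -> (forall q, 0 <= nu2 q)%E ->
  (0 <= otimes nu1 nu2 p)%E.
Proof.
move=> h1 h2; apply: le_ereal_inf_tmp => _ [a [b [_ _ _ ->]]].
exact: mule_ge0.
Qed.

Lemma zeta_from_ge0 {R : realType} (nu : nat -> R -> \bar R) k m p :
  (forall m q, 0 <= nu m q)%E -> (0 <= zeta_from nu k m p)%E.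
Proof.
move=> nu0; elim: k m p => [|k IH] m p /=; apply: mule_ge0 => //.
- by rewrite (le_trans _ (K_I_ge1 p))// lee_fin.
- by rewrite (le_trans _ (K_M_ge1 p))// lee_fin.
- by apply: otimes_ge0 => q; [exact: IH|exact: nu0].
Qed.

(** Dividing the weights by their Euclidean norm brings them to the unit sphere. If this norm is
    zero, all weights vanish and both sides are 0. *)
Lemma Lp_norm_sum_homog {d} {T : measurableType d} {R : realType}
    (P : probability T R) (p : R) (C : \bar R) (I : finType)
    (theta : I -> T -> R) (a : I -> R) :
    0 < p -> (0 <= C)%E -> (forall i, measurable_fun setT (theta i)) ->
    (forall b : I -> R, (\sum_i b i ^+ 2 = 1)%R ->
      Lp_norm P p (fun w => \sum_i b i * theta i w)%R <= C)%E ->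
  (Lp_norm P p (fun w => \sum_i a i * theta i w)%R <=
   (Num.sqrt (\sum_i a i ^+ 2))%:E * C)%E.
Proof.
move=> p0 C0 mt H; set s := Num.sqrt _.
have s2 : \sum_i a i ^+ 2 = s ^+ 2.
  by rewrite sqr_sqrtr// sumr_ge0// => i _; exact: sqr_ge0.
have [s0|s0] := eqVneq s 0.
  move/eqP: s2; rewrite s0 expr0n/= psumr_eq0; last first.
    by move=> i _; exact: sqr_ge0.
  move=> /allP a0; rewrite mul0e (_ : (fun w => _) = cst 0).
    by rewrite /Lp_norm (_ : EFin \o _ = cst 0%E)// Lnorm0 ?eqe ?gt_eqF.
  apply/funext => w; rewrite big1// => i _.
  by have := a0 i (mem_index_enum i); rewrite /= sqrf_eq0 => /eqP ->; rewrite mul0r.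
have s_gt0 : 0 < s by rewrite lt_neqAle eq_sym s0 sqrtr_ge0.
rewrite (_ : (fun w => _) = fun w => s * \sum_i (a i / s) * theta i w).
  rewrite Lp_normZ//; last first.
    by apply: measurable_sum => i; exact: measurable_funM.
  rewrite gtr0_norm// lee_pmul2l//; apply: H.
  under eq_bigr do rewrite exprMn.
  by rewrite -mulr_suml s2 exprVn mulfV// expf_neq0.
apply/funext => w; rewrite mulr_sumr; apply: eq_bigr => i _.
by rewrite mulrA mulrCA mulfV// mulr1.
Qed.

(** * Induction on the degree for a finite upper end *)

Section multi_poly_bound.
Context {d0} {T : measurableType d0} {R : realType} (P : probability T R).
Variables (F : nat -> set (set T)) (xi : nat -> nat -> {RV P >-> R}).
Variables (d n0 M : nat) (nu : nat -> R -> \bar R).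
Hypothesis rF : reverse_filtration F.
Hypothesis xi_diff : forall m, (1 <= m <= d)%N ->
  reverse_martingale_differences P [set` in_range n0 (Some M)] F
    (fun i => xi i m).
Hypothesis xi_ind : forall m, (1 <= m <= d)%N ->
  mutually_independent P [set` in_range n0 (Some M)] (fun i => xi i m).
Hypothesis nu0 : forall m q, (0 <= nu m q)%E.
Hypothesis xi_nu : forall m q i, in_range n0 (Some M) i ->
  (Lp_norm P q (xi i m) <= nu m q)%E.

Let xi_poly := multi_poly (fun i m => xi i m : T -> R) M.

Let F_sub i j : (i <= j)%N -> F j `<=` F i.
Proof.
move=> /subnK <-; elim: (j - i)%N => [//|k IH].
by apply: subset_trans IH; rewrite addSn; exact: rF.2.
Qed.

Let in_rangeB n (j : 'I_(M.+1 - n)) : (n0 <= n)%N ->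
  in_range n0 (Some M) (M - j) /\ (n <= M - j)%N.
Proof.
move=> n0n; have jn := ltn_ord j.
have nj : (n <= M - j)%N.
  by rewrite leq_subRL -ltnS; [rewrite addnC -ltn_subRL|rewrite (leq_trans jn)// leq_subr].
by split=> //; rewrite /in_range /= leq_subr (leq_trans n0n).
Qed.

(** Only indices at least [n] occur, and the sigma-algebras decrease with the index. *)
Lemma measurable_wrt_multi_poly k m n c : (n0 <= n)%N -> (1 <= m)%N ->
  (m + k <= d.+1)%N -> measurable_wrt (F n) (xi_poly k m n c).
Proof.
elim: k m n c => [|k IH] m n c n0n m1 mk.
  exact: measurable_wrt_cst (rF.1 n) _.
rewrite (_ : xi_poly _ _ _ _ = fun w => \sum_(j < M.+1 - n) xi (M - j)%N m w *
    xi_poly k m.+1 (M - j).+1 (fun s => c ((M - j)%N :: s)) w); last first.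
  by apply/funext => w; rewrite /xi_poly /= sum_rev_ord.
apply: (measurable_wrt_sum (rF.1 n)) => j.
have [jr nj] := in_rangeB j n0n.
have md : (1 <= m <= d)%N by rewrite m1 -ltnS (leq_trans _ mk)// addnS ltnS leq_addr.
apply: (measurable_wrtM (rF.1 n)).
  by move=> B mB; apply: (F_sub nj); have [+ _ _] := xi_diff md jr; exact.
move=> B mB; apply: (@F_sub n (M - j).+1); first exact: leqW.
by apply: IH => //; [rewrite leqW// (leq_trans n0n)|rewrite addSnnS].
Qed.

Let measurable_xi_poly k m n c : (n0 <= n)%N -> (1 <= m)%N ->
  (m + k <= d.+1)%N -> measurable_fun setT (xi_poly k m n c).
Proof.
move=> n0n m1 mk.
exact: (measurable_wrt_measurable_fun (rF.1 n)) (measurable_wrt_multi_poly _ n0n m1 mk).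
Qed.

Let base_bound m n c p : 0 < p -> (n0 <= n)%N -> (1 <= m <= d)%N ->
  (Lp_norm P p (xi_poly 1 m n c) <=
   (Num.sqrt (multi_sum M 1 n (fun s => c s ^+ 2)))%:E * (K_I p * nu m p))%E.
Proof.
move=> p0 n0n md.
rewrite /xi_poly/= sum_rev_ord (_ : (fun w => _) = fun w =>
    \sum_(j < M.+1 - n) c [:: (M - j)%N] * xi (M - j)%N m w); last first.
  apply/funext => w; rewrite /= sum_rev_ord.
  by apply: eq_bigr => j _; rewrite mulrC.
apply: (@Lp_norm_sum_homog _ _ _ P p _ _ (fun j : 'I_(M.+1 - n) => xi (M - j)%N m)
    (fun j => c [:: (M - j)%N])) => //.
  by rewrite mule_ge0// (le_trans _ (K_I_ge1 p))// lee_fin.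
move=> b b1; apply: K_I_bound => //.
- by move=> j; apply: xi_nu; exact: (in_rangeB j n0n).1.
- move=> J B _ mB.
  pose f (j : 'I_(M.+1 - n)) := (M - j)%N.
  have f_inj : injective f.
    move=> i j /(congr1 (fun x => M - x)%N).
    have le (l : 'I_(M.+1 - n)) : (l <= M)%N.
      by rewrite -ltnS (leq_trans (ltn_ord l))// leq_subr.
    by rewrite /f !subKn// => /val_inj.
  (* Independence is known for families indexed by naturals, so the test sets are transported along
     the injection [f]; indices outside its image receive the whole line. *)
  pose B' (i : nat) := if [pick j | f j == i] is Some j then B j else setT.
  have B'f j : B' (f j) = B j.
    rewrite /B'; case: pickP => [l /eqP /f_inj -> //|/(_ j)].
    by rewrite eqxx.
  have /= := xi_ind md (J := (f @` J)%fset) (B := B').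
  rewrite big_imfset/=; last by move=> x y _ _; exact: f_inj.
  under eq_bigr do rewrite B'f.
  move=> <-.
  + congr (P _); apply/seteqP; split => w Hw.
      by move=> _ /imfsetP[j /= jJ ->]; rewrite B'f; exact: Hw.
    by move=> j jJ; rewrite -B'f; apply: (Hw (f j)); exact: in_imfset.
  + by move=> _ /imfsetP[j _ ->]; exact: (in_rangeB j n0n).1.
  + by move=> i; rewrite /B'; case: pickP.
- by move=> j; have [_ + _] := xi_diff md (in_rangeB j n0n).1.
Qed.

(** The square root makes the bound homogeneous in the coefficients, so the induction hypothesis
    applies to each [U i] without normalisation. The condition [1 <= p] is stable under passing to
    [p / a] with [a] below 1, and it provides integrability. *)
Lemma multi_poly_bound k m n c p : 1 <= p -> (n0 <= n)%N -> (1 <= m)%N ->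
    (m + k <= d)%N ->
  (Lp_norm P p (xi_poly k.+1 m n c) <=
   (Num.sqrt (multi_sum M k.+1 n (fun s => c s ^+ 2)))%:E *
   zeta_from nu k m p)%E.
Proof.
elim: k m n c p => [|k IH] m n c p p1 n0n m1 mk.
  by apply: base_bound => //; [rewrite (lt_le_trans ltr01)|rewrite m1 -(addn0 m)].
have p0 : 0 < p by rewrite (lt_le_trans ltr01).
have md : (1 <= m <= d)%N by rewrite m1 (leq_trans _ mk)// leq_addr.
pose N := (M.+1 - n)%N.
pose q (i : nat) := multi_sum M k.+1 i.+1 (fun s => c (i :: s) ^+ 2).
have q0 i : 0 <= q i.
  by rewrite /q multi_sumE sumr_ge0// => s _; exact: sqr_ge0.
pose U i := xi_poly k.+1 m.+1 i.+1 (fun s => c (i :: s)).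
(* If [q i = 0] then [W i = 0] because [0^-1 = 0], and [U i = 0] as well. *)
pose W i w := (Num.sqrt (q i))^-1 * U i w.
have UW i w : U i w = Num.sqrt (q i) * W i w.
  rewrite /W; have [qi0|qi0] := eqVneq (q i) 0.
    by rewrite /U/= [LHS]multi_poly_eq0// qi0 sqrtr0 mul0r.
  by rewrite mulrA mulfV ?mul1r// sqrtr_eq0 -ltNge lt_neqAle eq_sym qi0 q0.
have idx (j : 'I_N) := in_rangeB j n0n.
have mU (j : 'I_N) : measurable_wrt (F (M - j).+1) (W (M - j)%N).
  apply: (measurable_wrtM (rF.1 _)); first exact: measurable_wrt_cst (rF.1 _) _.
  apply: measurable_wrt_multi_poly => //.
  by rewrite leqW// (leq_trans n0n)// (idx j).2.
have mW (j : 'I_N) : measurable_fun setT (W (M - j)%N).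
  exact: (measurable_wrt_measurable_fun (rF.1 (M - j).+1) (mU j)).
(* Reversing the index, j = M - i, turns the reverse filtration into one. *)
pose theta (j : 'I_N) w := xi (M - j)%N m w * W (M - j)%N w.
have mtheta j : measurable_fun setT (theta j) by exact: measurable_funM.
pose thetaRV (j : 'I_N) : {RV P >-> R} := mfun_Sub (mem_set (mtheta j)).
pose S := otimes (zeta_from nu k m.+1) (nu m) p.
have S0 : (0 <= S)%E by apply: otimes_ge0 => // x; exact: zeta_from_ge0.
have thetaS (j : 'I_N) : (Lp_norm P p (theta j) <= S)%E.
  (* [S] is an infimum, so each admissible pair is treated separately. The exponent [p / b] goes to
     the variable and [p / a] to the polynomial, since [otimes] lists [zeta_from] first. *)
  apply: le_ereal_inf_tmp => _ [a [b [a0 b0 ab1 ->]]].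
  have ba1 : b + a = 1 by rewrite addrC.
  apply: le_trans (Lp_norm_hoelder P p0 b0 a0 ba1 _ (mW j)) _ => //.
  rewrite muleC; apply: lee_pmul; [exact: Lp_norm_ge0|exact: Lp_norm_ge0| |].
    have pa1 : 1 <= p / a.
      rewrite ler_pdivlMr// mul1r (le_trans _ p1)// -ab1 lerDl ltW//.
    have mUj : measurable_fun setT (U (M - j)%N).
      apply: measurable_xi_poly => //.
      by rewrite leqW// (leq_trans n0n)// (idx j).2.
    rewrite Lp_normZ//; last by rewrite (lt_le_trans ltr01).
    have /(IH m.+1 _ (fun s => c ((M - j)%N :: s)) _ pa1) : (n0 <= (M - j).+1)%N.
      by rewrite leqW// (leq_trans n0n)// (idx j).2.
    rewrite addSnnS => /(_ isT mk) HU.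
    rewrite ger0_norm ?invr_ge0 ?sqrtr_ge0//.
    apply: (@le_trans _ _ (((Num.sqrt (q (M - j)%N))^-1)%:E *
        ((Num.sqrt (q (M - j)%N))%:E * zeta_from nu k m.+1 (p / a)))%E).
      by apply: lee_wpmul2l HU; rewrite lee_fin invr_ge0 sqrtr_ge0.
    rewrite muleA -EFinM; have [->|s0] := eqVneq (Num.sqrt (q (M - j)%N)) 0.
      by rewrite mulr0 mul0e zeta_from_ge0.
    by rewrite mulVf// mul1e.
  exact/xi_nu/(idx j).1.
rewrite (_ : xi_poly _ _ _ _ = fun w =>
    \sum_(j < N) Num.sqrt (q (M - j)%N) * theta j w); last first.
  apply/funext => w; rewrite /xi_poly/= sum_rev_ord; apply: eq_bigr => j _.
  by rewrite [X in _ * X](UW (M - j)%N w) mulrCA.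
(* Grouping the squared coefficients by their smallest index shows that the weights have exactly the
   required Euclidean norm. *)
rewrite (_ : multi_sum _ _ _ _ = \sum_(j < N) Num.sqrt (q (M - j)%N) ^+ 2); last first.
  rewrite /= sum_rev_ord; apply: eq_bigr => j _.
  by rewrite sqr_sqrtr.
apply: Lp_norm_sum_homog => //.
  rewrite mule_ge0//; first by rewrite (le_trans _ (K_M_ge1 p))// lee_fin.
move=> b b1.
apply: (@K_M_bound _ _ _ P p S N thetaRV b p0 S0 b1 thetaS (fun j => F (M - j)%N)).
  split=> [i|i j ij]; first exact: rF.1.
  by apply: F_sub; rewrite leq_sub2l.
move=> Soo j.
have [xi_meas [xi_int xi0] xi_ce] := xi_diff md (idx j).1.
have itheta : P.-integrable setT (EFin \o theta j).
  apply: (Lp_norm_integrable p1) => //.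
  exact: le_lt_trans (thetaS j) Soo.
split.
- apply: (measurable_wrtM (rF.1 _)) => // B mB.
  by apply: (F_sub (leqnSn _)); exact: (mU j).
(* The factor [W (M - j)] is measurable for the sigma-algebra at [(M - j).+1], given which the
   variable has conditional mean zero. *)
- split=> //; rewrite unlock.
  exact: (integral_mul_cond_exp0 (rF.1 (M - j).+1) xi_int (xi_ce _ (ltnSn _)) (mU j)).
- move=> l lj; apply: (is_cond_exp0M (rF.1 (M - j).+1) xi_int) => //.
  + exact: xi_ce.
  + exact: rF.1.
  (* An earlier time [l] corresponds to a larger index [M - l]. Truncated subtraction is strict here
     because [l < j] and [j] is at most [M]. *)
  + apply: F_sub; rewrite ltn_sub2l// (leq_trans lj)// -ltnS.
    by rewrite (leq_trans (ltn_ord j))// leq_subr.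
Qed.

End multi_poly_bound.

(** * Lower bound for the right-hand side and assembly *)

(** At [y = +oo] the inverse is 0; at [y = 0] the numerator is 0 as well, and 0 times the infinite
    inverse is 0. *)
Lemma dive_le1 {R : realType} (x y : \bar R) :
  (0 <= x)%E -> (x <= y)%E -> (x / y <= 1)%E.
Proof.
move=> x0 xy; have y0 := le_trans x0 xy.
case: y xy y0 => [y|_ _|//]; last by rewrite invey mule0 lee01.
move=> xy; rewrite lee_fin le_eqVlt => /predU1P[y0|y0].
  have -> : x = 0%E by apply/eqP; rewrite eq_le x0 andbT (le_trans xy)// -y0.
  by rewrite mul0e lee01.
by rewrite inver gt_eqF// lee_pdivrMr// mul1e.
Qed.

(** One exponent p between 2 and [r] is enough: there [nu p] is positive and finite, and the
    supremum of the moments divided by [nu p] is at least 1. *)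
Lemma G_norm_family_sup_moment_ge1 {d} {T : measurableType d} {R : realType}
    (P : probability T R) (A : set nat) (r : \bar R) (X : nat -> T -> R) :
  class_G (sup_moment P A X) r ->
  (1 <= G_norm_family P A (sup_moment P A X) r X)%E.
Proof.
set nu := sup_moment P A X; case=> r2 _ nu_fin _ _.
have [p p2 pr] : exists2 p : R, 2 < p & (p%:E < r)%E.
  case: r r2 {nu_fin} => [r|_|//].
    by rewrite lte_fin => /midf_lt[r2 r2r]; exists ((2 + r) / 2).
  by exists 3; rewrite ?ltry// ltr_nat.
have /andP[nup0 nupoo] := nu_fin p (ltW (lt_trans (ltr1n _ 2) p2)) pr.
have nupfin : nu p \is a fin_num by rewrite ge0_fin_numE// ltW.
have fnup0 : 0 < fine (nu p) by rewrite fine_gt0// nup0.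
apply: (@le_trans _ _ (nnsup [set (Lp_norm P p (X i) / nu p)%E | i in A])).
  (* After multiplication by [nu p] the claim can be checked moment by moment. *)
  set s := nnsup _.
  rewrite -(@lee_pmul2r _ (fine (nu p))%:E)// ?lte_fin// fineK// mul1e.
  apply: ge_nnsup => [|_ [i Ai <-]].
    by rewrite mule_ge0// ?nnsup_ge0// ltW.
  rewrite -(fineK nupfin) -lee_pdivrMr//.
  apply: nnsup_ubound; exists i => //.
  by rewrite -[in LHS](fineK nupfin) inver gt_eqF.
by apply: nnsup_ubound; exists p.
Qed.

(** A finite partial sum of a nonnegative family with total 1; a truncation of an infinite range may
    lose mass, hence an inequality. *)
Lemma multi_sum_sqr_le1 {R : realType} (n M d : nat) (N : option nat)
    (b : d.-tuple nat -> R) : unit_arrays n N d b ->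
    (forall i, in_range n (Some M) i -> in_range n N i) ->
  multi_sum M d n (fun s => b (insubd (nseq_tuple d 0%N) s) ^+ 2) <= 1.
Proof.
move=> b1 MN; rewrite -fsum_multi_indices -lee_fin -b1.
have fin := finite_multi_indices M d n.
apply: esum_ge; exists (multi_indices n (Some M) d).
  split => // I /andP[sI /allP rI]; apply/andP; split => //.
  by apply/allP => i /rI /MN.
rewrite -fsumEFin// le_eqVlt; apply/predU1P; left; apply: eq_fsbigr => I _.
by rewrite valKd.
Qed.

Theorem theorem7p3 (R : realType) (disp : measure_display)
    (T : measurableType disp) (P : probability T R)
    (d n : nat) (N : option nat)
    (F : nat -> set (set T)) (xi : nat -> nat -> {RV P >-> R})
    (r_ : nat -> \bar R) (r : \bar R) (nu : nat -> R -> \bar R) :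
  (1 <= d)%N -> (1 <= n)%N -> le_upper n N ->
  reverse_filtration F ->
  (forall m, (1 <= m <= d)%N ->
     reverse_martingale_differences P [set` in_range n N] F
       (fun i => xi i m)) ->
  (forall m, (1 <= m <= d)%N ->
     mutually_independent P [set` in_range n N] (fun i => xi i m)) ->
  (forall m, nu m = sup_moment P [set` in_range n N] (fun i => xi i m)) ->
  (forall m, (1 <= m <= d)%N -> class_G (nu m) (r_ m)) ->
  r = ((\sum_(1 <= m < d.+1) (r_ m)^-1)^-1)%E ->
  (1 < r)%E ->
  (nnsup [set G_norm P (zeta nu d 1) r (V xi n N b)
         | b in unit_arrays n N d `&` V_defined P xi n N (d:=d)]
   <= \prod_(1 <= m < d.+1)
        G_norm_family P [set` in_range n N] (nu m) (r_ m)
          (fun i => xi i m))%E.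
Proof.
move=> d1 _ _ rF xi_diff xi_ind nuE nuG _ _.
apply: (@le_trans _ _ 1%E); last first.
  rewrite big_nat; elim/big_ind: _ => // [x y x1 y1|m md].
    by rewrite -[leLHS]mule1; apply: lee_pmul.
  by rewrite nuE; apply: G_norm_family_sup_moment_ge1; rewrite -nuE; exact: nuG.
have nu0 m q : (0 <= nu m q)%E by rewrite nuE; exact: nnsup_ge0.
apply: ge_nnsup => // _ [b [b1 bV] <-]; apply: ge_nnsup => // _ [p [p2 _] <-].
apply: dive_le1; first exact: Lp_norm_ge0.
have p1 : 1 <= p by apply: ltW (lt_trans _ p2); rewrite ltr1n.
have p0 : 0 < p by apply: lt_le_trans p1.
pose c s := b (insubd (nseq_tuple d 0%N) s).
have zeta0 : (0 <= zeta nu d 1 p)%E by exact: zeta_from_ge0.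
(* Uniform in the truncation level, so that it serves a finite upper end directly and an infinite
   one through the limit. *)
have bound M : (forall i, in_range n (Some M) i -> in_range n N i) ->
    measurable_fun setT (V_finite (fun i m => xi i m : T -> R) n M b) /\
    (Lp_norm P p (V_finite (fun i m => xi i m : T -> R) n M b) <= zeta nu d 1 p)%E.
  move=> MN.
  have xi_diffM m : (1 <= m <= d)%N -> reverse_martingale_differences P
      [set` in_range n (Some M)] F (fun i => xi i m).
    by move=> md i /MN; exact: xi_diff.
  have xi_indM m : (1 <= m <= d)%N -> mutually_independent P
      [set` in_range n (Some M)] (fun i => xi i m).
    move=> md J B JM mB; apply: xi_ind => //.
    by apply: subset_trans JM _ => i; exact: MN.
  have xi_nu m q i : in_range n (Some M) i -> (Lp_norm P q (xi i m) <= nu m q)%E.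
    by move=> /MN iN; rewrite nuE; apply: nnsup_ubound; exists i.
  have -> : V_finite (fun i m => xi i m : T -> R) n M b =
      multi_poly (fun i m => xi i m : T -> R) M d 1 n c.
    by apply/funext => w; rewrite V_finiteE.
  split.
    apply: (measurable_wrt_measurable_fun (rF.1 n)).
    exact: measurable_wrt_multi_poly rF xi_diffM _ _ _ _ _ _ _.
  have d1K : d = d.-1.+1 by rewrite prednK.
  rewrite {1}d1K.
  apply: le_trans (multi_poly_bound rF xi_diffM xi_indM nu0 xi_nu c p1 _ _ _) _ => //.
    by rewrite add1n -d1K.
  rewrite -d1K /zeta subn1 -[leRHS]mul1e.
  apply: lee_wpmul2r; first exact: zeta_from_ge0.
  by rewrite lee_fin -sqrtr1 ler_wsqrtr// (multi_sum_sqr_le1 b1).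
case: N b1 bV bound {xi_diff xi_ind nuE} => [M|] b1 bV bound.
  by apply: (bound M _).2.
(* For an infinite upper end, [bV] supplies the almost sure convergence of the truncated sums. *)
apply: Lp_norm_limn => //.
- by move=> M; apply: (bound M _).1 => i /andP[ni _]; rewrite /in_range ni.
- by move=> M; apply: (bound M _).2 => i /andP[ni _]; rewrite /in_range ni.
Qed.
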